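(* Let $G$ be a finitely generated group, $N\trianglelefteq G$ a finitely generated normal subgroup, $\pi:G\to G/N$ the quotient map, $X\subseteq A^{G/N}$ a $G/N$-subshift over a finite alphabet $A$, and $\pi^*(X)\subseteq A^G$ its pull-back. Then for any section $\rho:G/N\to G$, $$\mathrm{stab}(\pi^*(X))=\rho(\mathrm{stab}(X))N:=\{\rho(K)N : K\in \mathrm{stab}(X)\}.$$ In particular, if a family $\mathcal G$ of subgroups of $G/N$ is realizable in $G/N$, then $\rho(\mathcal G)N=\{\rho(H)N : H\in\mathcal G\}$ is realizable in $G$.
   Context: Let $K$ be a group and $A$ a non-empty finite set. $K$ acts on $A^K$ by $(g\cdot x)(h)=x(g^{-1}h)$. A pattern is a map $p:F\to A$ with $F\subset K$ finite; it appears in $x\in A^K$ if there is $g\in K$ with $p(h)=x(gh)$ for all $h\in F$. A $K$-subshift is a set $X\subseteq A^K$ consisting of exactly those configurations in which no pattern of some given set $\mathcal F$ of patterns appears; it is a $K$-SFT if $\mathcal F$ can be chosen finite. For $x\in A^K$, $\mathrm{stab}(x)=\{g\in K: g\cdot x=x\}$, and $\mathrm{stab}(X)=\{\mathrm{stab}(x): x\in X\}$. A family $\mathcal G$ of subgroups of $K$ is realizable in $K$ if there exist a finite alphabet $A$ and a non-empty $K$-SFT $X\subseteq A^K$ with $\mathrm{stab}(X)=\mathcal G$. The pull-back of a $G/N$-subshift $X\subseteq A^{G/N}$ is the $G$-subshift $\pi^*(X)=\{x\circ\pi\in A^G : x\in X\}$. A section is a map (not necessarily a homomorphism) $\rho:G/N\to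 G$ with $\pi\circ\rho=\mathrm{id}$. For $K\le G/N$, $\rho(K)N=\{\rho(k)n: k\in K, n\in N\}$. *)

(* Defs.v *)
From HB Require Import structures.
From mathcomp Require Import all_boot finmap all_classical.

Set Implicit Arguments.
Unset Strict Implicit.
Unset Printing Implicit Defensive.

Local Open Scope group_scope.
Local Open Scope quotient_scope.
Local Open Scope classical_set_scope.

Definition is_subgroup (G : groupType) (H : set G) : Prop :=
  group_closed [in H].

Definition generated_subgroup (G : groupType) (S : set G) : set G :=
  smallest (@is_subgroup G) S.

Definition finitely_generated (G : groupType) (H : set G) : Prop :=
  exists2 S : set G, finite_set S & generated_subgroup S = H.

Record normal_subgroup (G : groupType) := NormalSubgroup {
  normal_set :> set G;
  normal_is_subgroup : is_subgroup normal_set;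
  normal_conjg : forall n g : G, normal_set n -> normal_set (n ^ g)
}.

Section Quotient.
Variables (G : groupType) (N : normal_subgroup G).
Implicit Types x y z : G.

Fact normal_set1 : normal_set N 1.
Proof. exact: (set_mem (normal_is_subgroup N).1). Qed.

Fact normal_setV x : normal_set N x -> normal_set N x^-1.
Proof.
move=> Nx; apply: set_mem.
exact: (group_closedV (normal_is_subgroup N)) (mem_set Nx).
Qed.

Fact normal_setM x y :
  normal_set N x -> normal_set N y -> normal_set N (x * y).
Proof.
move=> Nx Ny; apply: set_mem.
exact: (group_closedM (normal_is_subgroup N)) (mem_set Nx) (mem_set Ny).
Qed.

(* The classes of this relation are the left cosets [x N]. *)
Definition coset_rel : rel G := fun x y => `[< normal_set N (x^-1 * y) >].

Fact coset_rel_refl : reflexive coset_rel.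
Proof. by move=> x; apply/asboolP; rewrite mulVg; apply: normal_set1. Qed.

Fact coset_rel_sym : symmetric coset_rel.
Proof.
move=> x y; apply/asboolP/asboolP => /normal_setV; by rewrite invgM invgK.
Qed.

Fact coset_rel_trans : transitive coset_rel.
Proof.
move=> y x z /asboolP xy /asboolP yz; apply/asboolP.
by have := normal_setM xy yz; rewrite -mulgA mulVKg.
Qed.

Canonical coset_equiv :=
  EquivRel coset_rel coset_rel_refl coset_rel_sym coset_rel_trans.

Definition quotient := {eq_quot coset_equiv}.

HB.instance Definition _ := EqQuotient.on quotient.
HB.instance Definition _ := Choice.on quotient.

Lemma eq_coset x y :
  \pi_quotient x = \pi_quotient y <-> normal_set N (x^-1 * y).
Proof. by split=> [/eqmodP/asboolP|?] //; apply/eqmodP/asboolP. Qed.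

Definition quotient_one : quotient := \pi_quotient 1.
Definition quotient_inv (u : quotient) : quotient := \pi_quotient (repr u)^-1.
Definition quotient_mul (u v : quotient) : quotient :=
  \pi_quotient (repr u * repr v).

Fact pi_inv x : quotient_inv (\pi_quotient x) = \pi_quotient x^-1.
Proof.
have /eq_coset Nxr : \pi_quotient x = \pi_quotient (repr (\pi_quotient x)).
  by rewrite reprK.
apply/eq_coset; rewrite invgK.
have := normal_conjg x^-1 Nxr.
by rewrite /conjg invgK -!mulgA mulVKg.
Qed.

Fact pi_mul x y :
  quotient_mul (\pi_quotient x) (\pi_quotient y) = \pi_quotient (x * y).
Proof.
have /esym/eq_coset Nx :
    \pi_quotient x = \pi_quotient (repr (\pi_quotient x)) by rewrite reprK.
have /esym/eq_coset Ny :
    \pi_quotient y = \pi_quotient (repr (\pi_quotient y)) by rewrite reprK.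
apply/eq_coset; move: (repr _) (repr (\pi_quotient y)) Nx Ny => a b Nx Ny.
have := normal_setM (normal_conjg b Nx) Ny.
by rewrite invgM /conjg -!mulgA mulVKg.
Qed.

Fact quotient_mulA : associative quotient_mul.
Proof.
by move=> u v w; rewrite -[u]reprK -[v]reprK -[w]reprK !pi_mul mulgA !reprK.
Qed.

Fact quotient_mul1 : left_id quotient_one quotient_mul.
Proof. by move=> u; rewrite -[u]reprK pi_mul mul1g. Qed.

Fact quotient_1mul : right_id quotient_one quotient_mul.
Proof. by move=> u; rewrite -[u]reprK pi_mul mulg1. Qed.

Fact quotient_mulV : left_inverse quotient_one quotient_inv quotient_mul.
Proof. by move=> u; rewrite -[u]reprK pi_inv pi_mul mulVg. Qed.

Fact quotient_Vmul : right_inverse quotient_one quotient_inv quotient_mul.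
Proof. by move=> u; rewrite -[u]reprK pi_inv pi_mul mulgV. Qed.

HB.instance Definition _ := isGroup.Build quotient
  quotient_mulA quotient_mul1 quotient_1mul quotient_mulV quotient_Vmul.

Lemma pi_morphism : monoid_morphism \pi_quotient.
Proof. by split=> // x y; rewrite -pi_mul. Qed.

End Quotient.

Section Subshifts.
Variables (K : groupType) (A : finType).
Implicit Types (x : K -> A) (X : set (K -> A)).

Definition shift (g : K) x : K -> A := fun h => x (g^-1 * h).

(* A pattern is a finite partial map; its support [F] is [domf p]. *)
Definition pattern := {fmap K -> A}.

Definition appears (p : pattern) x : Prop :=
  exists g : K, forall h : domf p, p h = x (g * fsval h).

Definition subshift_of (FF : set pattern) : set (K -> A) :=
  [set x | forall p, FF p -> ~ appears p x].

Definition is_subshift X : Prop := exists FF, X = subshift_of FF.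

Definition is_SFT X : Prop := exists2 FF, finite_set FF & X = subshift_of FF.

Definition stab x : set K := [set g | shift g x = x].

Definition stab_family X : set (set K) := [set stab x | x in X].

End Subshifts.

Definition realizable (K : groupType) (GG : set (set K)) : Prop :=
  (forall H, GG H -> is_subgroup H) /\
  exists A : finType, (0 < #|A|)%N /\
    exists X : set (K -> A), [/\ is_SFT X, X !=set0 & stab_family X = GG].

Definition pullback (G : groupType) (N : normal_subgroup G) (A : finType)
    (X : set (quotient N -> A)) : set (G -> A) :=
  [set x \o \pi_(quotient N) | x in X].

(* [lift_by rho H] is the subset rho(H)N of [G]. *)
Definition lift_by (G : groupType) (N : normal_subgroup G)
    (rho : quotient N -> G) (H : set (quotient N)) : set G :=
  [set rho k * n | k in H & n in (N : set G)].

(* Main.v *)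
Require Import Defs.
From HB Require Import structures.
From mathcomp Require Import all_boot finmap all_classical.

(** The stabilizer of a pulled-back configuration [x \o \pi] is the preimage
    under [\pi] of the stabilizer of [x]: shifting [x \o \pi] by [g] is the
    same as shifting [x] by [\pi g], and [\pi] is onto, so nothing is lost when
    two configurations of [G/N] are compared through [\pi].  On the other hand
    [rho(H)N] is the preimage of [H], whatever the section [rho]
    ([lift_by_preimage]).  The two together give [stab_family_pullback].

    For realizability it remains to see that the pull-back of an SFT is an SFT
    ([pullback_SFT]).  The forbidden patterns are not written down one by one.
    By [SFT_of_windows], it is enough to give finitely many supports
    (windows) such that a configuration belongs to the pull-back as soon as
    everything seen in it through these windows is also seen in some element
    of the pull-back: over a finite alphabet there are finitely many patterns
    with these supports, and those that never occur in the pull-back can be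
    forbidden.  Two kinds of windows suffice.  The windows [{1, s}], for [s]
    in a finite generating set of [N], force [x g = x (g * s)], hence force [x]
    to be constant on the cosets [gN], so that [x = y \o \pi]; this is where
    the finite generation of [N] enters.  The windows obtained from the supports of the
    forbidden patterns of [X] by choosing a representative of each coset then
    force [y] into [X]: whatever is seen through them in an element of the
    pull-back is, after projection, seen in an element of [X]. *)

Local Open Scope group_scope.
Local Open Scope quotient_scope.
Local Open Scope classical_set_scope.

(** * Stabilizers of pulled-back configurations *)

Lemma shift_pullback (G : groupType) (N : normal_subgroup G) (A : finType)
    (x : quotient N -> A) (g : G) :
  shift g (x \o \pi_(quotient N)) =
  shift (\pi_(quotient N) g) x \o \pi_(quotient N).
Proof.
by apply/funext => h; rewrite /shift /= (pi_morphism N).2 -pi_inv.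
Qed.

Lemma pullback_inj (G : groupType) (N : normal_subgroup G) (A : Type)
    (x y : quotient N -> A) :
  x \o \pi_(quotient N) = y \o \pi_(quotient N) -> x = y.
Proof.
by move=> xy; apply/funext => u; rewrite -[u]reprK; apply: (congr1 (@^~ _) xy).
Qed.

Lemma stab_pullback (G : groupType) (N : normal_subgroup G) (A : finType)
    (x : quotient N -> A) :
  stab (x \o \pi_(quotient N)) = \pi_(quotient N) @^-1` stab x.
Proof.
apply/seteqP; split=> g; rewrite /stab /= shift_pullback; last by move=> ->.
exact: pullback_inj.
Qed.

Lemma lift_by_preimage (G : groupType) (N : normal_subgroup G)
    (rho : quotient N -> G) (H : set (quotient N)) :
  cancel rho \pi_(quotient N) -> lift_by rho H = \pi_(quotient N) @^-1` H.
Proof.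
move=> rhoK; apply/seteqP; split=> [_ [k Hk [n Nn <-]]|g Hg].
  rewrite /preimage /= -[X in H X](_ : k = _) //.
  by rewrite -[LHS]rhoK; apply/eq_coset; rewrite mulKg.
exists (\pi_(quotient N) g) => //.
exists ((rho (\pi_(quotient N) g))^-1 * g); last first.
  by rewrite mulVKg.
by apply/eq_coset; rewrite rhoK.
Qed.

Lemma stab_family_pullback (G : groupType) (N : normal_subgroup G)
    (A : finType) (rho : quotient N -> G) (X : set (quotient N -> A)) :
  cancel rho \pi_(quotient N) ->
  stab_family (pullback X) = [set lift_by rho H | H in stab_family X].
Proof.
move=> rhoK; rewrite /stab_family /pullback !image_comp.
by apply: eq_imagel => x _; rewrite /= stab_pullback lift_by_preimage.
Qed.

Lemma is_subgroup_pi_preimage (G : groupType) (N : normal_subgroup G)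
    (H : set (quotient N)) :
  is_subgroup H -> is_subgroup (\pi_(quotient N) @^-1` H).
Proof.
move=> [H1 HV]; split=> [|g h /set_mem Hg /set_mem Hh]; apply/mem_set => /=.
  exact: set_mem H1.
rewrite (pi_morphism N).2 -pi_inv; apply: set_mem.
exact: HV (mem_set Hg) (mem_set Hh).
Qed.

(** * Subshifts determined by finitely many windows *)

Lemma finite_patterns_on (K : groupType) (A : finType) (F : {fset K}) :
  finite_set [set p : pattern K A | domf p = F].
Proof.
apply: (sub_finite_set _
  (finite_image (fun f : {ffun F -> A} => FinMap f) (finite_finpred predT))).
by case=> D f /= DF; rewrite -DF; exists f.
Qed.

Definition restrict (K : groupType) (A : finType) (F : {fset K}) (g : K)
  (x : K -> A) : pattern K A := [fmap h : F => x (g * fsval h)].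

Lemma restrict_appears (K : groupType) (A : finType) (F : {fset K}) (g : K)
  (x : K -> A) : appears (restrict K A F g x) x.
Proof. by exists g => h; rewrite ffunE. Qed.

(** The forbidden patterns are those on the given windows that appear in no
    element of [Y]; finiteness of the alphabet leaves finitely many of them. *)
Lemma SFT_of_windows (K : groupType) (A : finType) (W : set {fset K})
    (Y : set (K -> A)) :
  finite_set W ->
  (forall x, (forall F g, W F ->
                exists2 y, Y y & appears (restrict K A F g x) y) -> Y x) ->
  is_SFT Y.
Proof.
move=> finW YW.
exists [set p | W (domf p) /\ forall y, Y y -> ~ appears p y].
  apply: (sub_finite_set _ (bigcup_finite finW
    (fun F _ => finite_patterns_on K A F))).
  by move=> p [Wp _]; exists (domf p).
apply/seteqP; split=> [x Yx p [_ noY]|x xFF]; first exact: noY Yx.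
apply: YW => F g WF; apply: contrapT => noy.
apply: (xFF _ _ (restrict_appears K A F g x)); split=> // y Yy xy.
by apply: noy; exists y.
Qed.

(** * Pull-backs of SFTs *)

(** The right periods of [x] form a subgroup, so it suffices to test the
    generators of [N]. *)
Lemma factors_through_quotient (G : groupType) (N : normal_subgroup G)
    (A : Type) (S : set G) (x : G -> A) :
  generated_subgroup S = N -> (forall g s, S s -> x (g * s) = x g) ->
  exists y : quotient N -> A, x = y \o \pi_(quotient N).
Proof.
move=> SN xS; pose P := [set n | forall g, x (g * n) = x g].
have subP : is_subgroup P.
  split=> [|n m /set_mem Pn /set_mem Pm]; apply/mem_set => g.
    by rewrite mulg1.
  by rewrite -[LHS]Pm -mulgA mulgVK Pn.
have NP : N `<=` P by rewrite -SN; apply: smallest_sub => // s Ss g; apply: xS.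
exists (x \o repr); apply/funext => g /=.
have /eq_coset/NP/(_ g) := esym (reprK (\pi_(quotient N) g)).
by rewrite mulVKg.
Qed.

Lemma pullback_SFT (G : groupType) (N : normal_subgroup G) (A : finType)
    (X : set (quotient N -> A)) :
  finitely_generated N -> is_SFT X -> is_SFT (pullback X).
Proof.
move=> [S finS SN] [FF finFF ->]; set Y := pullback _.
pose lift (p : pattern (quotient N) A) : {fset G} :=
  [fset repr (u : quotient N) | u in domf p]%fset.
apply: (@SFT_of_windows _ _
  ([set [fset 1; s]%fset | s in S] `|` [set lift p | p in FF])).
  by rewrite finite_setU; split; apply: finite_image.
move=> x xW.
have [y xE] : exists y : quotient N -> A, x = y \o \pi_(quotient N).
  apply: (factors_through_quotient _ _ _ _ _ SN) => g s Ss.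
  have [|z [z' _ <-] [g' zg']] := xW [fset 1; s]%fset g.
    by left; exists s.
  have := zg' (FSetSub (fset22 1 s)); have := zg' (FSetSub (fset21 1 s)).
  rewrite !ffunE /= !mulg1 => -> ->.
  (* Here [g'] and [g' * s] lie in the same coset of [N]. *)
  congr z'; apply/esym/eq_coset; rewrite mulKg -SN.
  exact: sub_gen_smallest.
exists y => // p FFp [k py].
have [|z [z' Xz' <-] [g zg]] := xW (lift p) (repr k).
  by right; exists p.
apply: (Xz' p FFp); exists (\pi_(quotient N) g) => u.
have up : repr (fsval u) \in lift p by apply/imfsetP; exists (fsval u).
have := zg (FSetSub up); rewrite py ffunE xE /= !(pi_morphism N).2 !reprK.
exact.
Qed.

Theorem proposition4p9 (G : groupType) (N : normal_subgroup G)
    (hG : finitely_generated [set: G]) (hN : finitely_generated N)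
    (rho : quotient N -> G) (hrho : cancel rho \pi_(quotient N)) :
  (forall A : finType, (0 < #|A|)%N ->
     forall X : set (quotient N -> A), is_subshift X ->
       stab_family (pullback X) = [set lift_by rho H | H in stab_family X])
  /\
  (forall GG : set (set (quotient N)), realizable GG ->
     realizable [set lift_by rho H | H in GG]).
Proof.
split=> [A _ X _|GG [subGG [A [A0 [X [SFTX [x Xx] XGG]]]]]].
  exact: stab_family_pullback.
split=> [_ [H GGH <-]|].
  rewrite lift_by_preimage //; apply: is_subgroup_pi_preimage.
  exact: subGG GGH.
exists A; split=> //; exists (pullback X); split.
- exact: pullback_SFT.
- by exists (x \o \pi_(quotient N)); exists x.
- by rewrite -XGG; apply: stab_family_pullback.
Qed.
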